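(* Let $\mathsf{M}\{xyxy\}$ be the monoid consisting of all factors of the word $xyxy$ (including the empty word $1$) together with a zero element $0$, where $\mathbf{u}\cdot\mathbf{v}=\mathbf{u}\mathbf{v}$ if the concatenation $\mathbf{u}\mathbf{v}$ is a factor of $xyxy$, and $\mathbf{u}\cdot\mathbf{v}=0$ otherwise. Then the monoid variety generated by $\mathsf{M}\{xyxy\}$ has exactly $2^{\aleph_0}$ subvarieties.
   Context: Monoids are algebras in the signature $\{\cdot,1\}$, and a monoid variety is a class of monoids closed under homomorphic images, submonoids and arbitrary direct products (equivalently, a class of monoids defined by identities). The monoid variety generated by a monoid $M$ is the smallest monoid variety containing $M$. A subvariety of a variety is a variety contained in it. A word $\mathbf{u}$ is a factor of a word $\mathbf{w}$ if $\mathbf{w}=\mathbf{a}\mathbf{u}\mathbf{b}$ for some possibly empty words $\mathbf{a},\mathbf{b}$. Here $x,y$ are distinct variables. *)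

(* Defs.v *)
From HB Require Import structures.
From mathcomp Require Import all_boot.
From mathcomp Require Import boolp.

Set Implicit Arguments.
Unset Strict Implicit.
Unset Printing Implicit Defensive.

Import Algebra.

Local Open Scope group_scope.

Section ProductMonoid.
Variables (I : Type) (M : I -> monoidType).

Definition prodMonoid : Type := forall i, M i.

HB.instance Definition _ := Choice.on prodMonoid.

Let pmul (f g : prodMonoid) : prodMonoid := fun i => f i * g i.
Let pone : prodMonoid := fun=> 1.

Let pmulA : associative pmul.
Proof. by move=> f g h; apply: functional_extensionality_dep => i; exact: mulgA. Qed.
Let pmul1f : left_id pone pmul.
Proof. by move=> f; apply: functional_extensionality_dep => i; exact: mul1g. Qed.
Let pmulf1 : right_id pone pmul.
Proof. by move=> f; apply: functional_extensionality_dep => i; exact: mulg1. Qed.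

HB.instance Definition _ := isMonoid.Build prodMonoid pmulA pmul1f pmulf1.
End ProductMonoid.

(* A class of monoids is a plain predicate: [set monoidType] would be
   universe-inconsistent.  By functional and propositional extensionality, two
   classes are equal exactly when they contain the same monoids. *)
Definition monoidClass := monoidType -> Prop.

Definition subclass (V W : monoidClass) : Prop := forall M, V M -> W M.

(* The submonoid clause also covers the isomorphic copies of the submonoids of
   [M]; any type [I] may index a product, including an empty one, so that a
   variety always contains the trivial monoid. *)
Record is_variety (V : monoidClass) : Prop := IsVariety {
  variety_image : forall (M N : monoidType) (f : M -> N),
    monoid_morphism f -> (forall y, exists x, f x = y) -> V M -> V N;
  variety_sub : forall (M : monoidType) (S : pred M) (N : subMonoidType S),
    V M -> V N;
  variety_prod : forall (I : Type) (M : I -> monoidType),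
    (forall i, V (M i)) -> V (prodMonoid M) }.

Definition generated_variety (M : monoidType) : monoidClass :=
  fun N => forall V, is_variety V -> V M -> V N.

Definition is_subvariety (W V : monoidClass) : Prop :=
  is_variety W /\ subclass W V.

(* Exactly [2 ^ aleph_0] classes satisfy [P]: [F] is a bijection from the set
   of binary sequences onto the collection [P]. *)
Definition has_continuum_many (P : monoidClass -> Prop) : Prop :=
  exists F : (nat -> bool) -> monoidClass,
    injective F /\ forall V, P V <-> exists s, F s = V.

(* [Some u] is the factor [u] of [w]; [None] is the zero element. *)
Section FactorMonoid.
Variables (A : choiceType) (w : seq A).

Definition factorMonoid : Type := option {u : seq A | infix u w}.

HB.instance Definition _ := Choice.on factorMonoid.

Let fmul (a b : factorMonoid) : factorMonoid :=
  match a, b with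
  | Some u, Some v => insub (val u ++ val v)
  | _, _ => None
  end.
Let fone : factorMonoid := Some (exist _ [::] (infix0s w)).

Let fmulA : associative fmul.
Proof.
move=> [u|] [v|] [t|] //=; last by case: insubP.
case: (insubP _ (val v ++ val t)) => [vt _ vtE|nvt];
  case: (insubP _ (val u ++ val v)) => [uv _ uvE|nuv] //=.
- by rewrite vtE uvE catA.
- rewrite vtE insubN //; apply: contra nuv; rewrite catA.
  exact: catr_infix.
- rewrite uvE insubN //; apply: contra nvt; rewrite -catA.
  exact: catl_infix.
Qed.
Let fmul1a : left_id fone fmul.
Proof. by move=> [u|] //=; rewrite valK. Qed.
Let fmula1 : right_id fone fmul.
Proof. by move=> [u|] //=; rewrite cats0 valK. Qed.

HB.instance Definition _ := isMonoid.Build factorMonoid fmulA fmul1a fmula1.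
End FactorMonoid.

(* The two distinct variables [x], [y] are [false], [true]. *)
Definition xyxy : seq bool := [:: false; true; false; true].

(* Main.v *)
(** A variety is determined by its identities over a countable alphabet
    (Birkhoff), so it has at most continuum many subvarieties; by
    Cantor-Bernstein it remains to inject the subsets of [nat].

    In a word all of whose letters occur twice, say that [i] crosses [j] if the
    occurrences of [i] and [j] read [ijij].  Identities of M{xyxy} preserve the
    multiplicities 0 and 2 and the crossings.  Let [u_n] be a word whose crossing
    graph is an (oriented) cycle on [0, ..., n], and [v_n] the square of
    [0 1 ... n].  If a word with the crossing graph of [u_n] has a nonempty factor
    that is an instance of [u_m] or [v_m], then, the graph being connected, this
    factor contains all the letters; hence the cycle of [u_n] is obtained from
    the graph of [u_m] or [v_m] by deleting vertices and blowing up others into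
    cliques.  For [m, n > 3] this excludes [v_m], and [u_m] unless [m = n].  So the
    syntactic monoid of the class of [u_n] satisfies [u_m = v_m] exactly when
    [m <> n], and these identities define pairwise distinct subvarieties. *)

Require Import Defs.
From HB Require Import structures.
From mathcomp Require Import all_boot zify.
From mathcomp Require Import boolp classical_sets functions cardinality.

Set Implicit Arguments.
Unset Strict Implicit.
Unset Printing Implicit Defensive.

Import Algebra.

Local Open Scope group_scope.

(** * Identities and Birkhoff's theorem *)

Definition eval (X : Type) (M : monoidType) (f : X -> M) (w : seq X) : M :=
  foldr (fun x m => f x * m) 1 w.

Lemma eval_cat (X : Type) (M : monoidType) (f : X -> M) (v w : seq X) :
  eval f (v ++ w) = eval f v * eval f w.
Proof. by elim: v => [|x v IHv] /=; rewrite ?mul1g // IHv mulgA. Qed.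

Lemma eval_map (X Y : Type) (M : monoidType) (h : X -> Y) (f : Y -> M)
    (w : seq X) :
  eval f (map h w) = eval (f \o h) w.
Proof. by elim: w => //= x w ->. Qed.

Lemma eq_in_eval (X : eqType) (M : monoidType) (f g : X -> M) (w : seq X) :
  {in w, f =1 g} -> eval f w = eval g w.
Proof.
elim: w => //= x w IHw fg; rewrite fg ?mem_head // IHw // => y yw.
by rewrite fg // inE yw orbT.
Qed.

Lemma eval_flatten (X Y : Type) (M : monoidType) (h : X -> seq Y) (f : Y -> M)
    (w : seq X) :
  eval f (flatten (map h w)) = eval (eval f \o h) w.
Proof. by elim: w => //= x w IHw; rewrite eval_cat IHw. Qed.

Lemma eval_morph (X : Type) (M N : monoidType) (g : M -> N) (f : X -> M)
    (w : seq X) :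
  monoid_morphism g -> g (eval f w) = eval (g \o f) w.
Proof. by case=> g1 gM; elim: w => //= x w <-. Qed.

Lemma eval_prod (X I : Type) (M : I -> monoidType)
    (f : X -> prodMonoid M) (w : seq X) (i : I) :
  eval f w i = eval (fun x => f x i) w.
Proof. by elim: w => //= x w <-. Qed.

Definition satisfies (X : Type) (M : monoidType) (p q : seq X) : Prop :=
  forall f : X -> M, eval f p = eval f q.

(** Only finitely many letters occur, so each is renamed to its index in [p ++ q]. This links
    identities over an arbitrary alphabet to [theory], which speaks of letters in [nat] only. *)
Lemma satisfies_nat (X : eqType) (p q : seq X) :
  exists p' q' : seq nat,
    (forall M : monoidType, satisfies M p q -> satisfies M p' q') /\
    (forall M : monoidType, satisfies M p' q' -> satisfies M p q).
Proof.
pose s := p ++ q.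
exists (map (index^~ s) p), (map (index^~ s) q); split=> M pq f.
  by rewrite !eval_map.
have evalE r : {subset r <= s} ->
    eval (nth 1 (map f s)) (map (index^~ s) r) = eval f r.
  move=> rs; rewrite eval_map; apply: eq_in_eval => x /rs xs /=.
  by rewrite (nth_map x) ?index_mem // nth_index.
by rewrite -!evalE // => x xs; rewrite mem_cat xs ?orbT.
Qed.

Section ImageMonoid.
Variables (X : Type) (M : monoidType) (f : X -> M).

Definition in_image : pred M := fun m => `[< exists w, eval f w = m >].

Lemma in_image_umagma_closed : umagma_closed in_image.
Proof.
split; first by apply/asboolP; exists [::].
move=> _ _ /asboolP[v <-] /asboolP[w <-]; apply/asboolP.
by exists (v ++ w); rewrite eval_cat.
Qed.

Definition imageMonoid : Type := {m | in_image m}.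

HB.instance Definition _ := SubChoice.on imageMonoid.
HB.instance Definition _ :=
  SubChoice_isSubMonoid.Build M in_image imageMonoid in_image_umagma_closed.
End ImageMonoid.


Lemma imageMonoid_variety (V : monoidClass) (X : Type) (M : monoidType)
    (f : X -> M) :
  is_variety V -> V M -> V (imageMonoid f).
Proof. by move=> varV; apply: (@variety_sub V varV M _ (imageMonoid f)). Qed.

Definition models (E : seq nat -> seq nat -> Prop) : monoidClass :=
  fun M => forall p q, E p q -> satisfies M p q.

Definition theory (V : monoidClass) (p q : seq nat) : Prop :=
  forall M, V M -> satisfies M p q.

Lemma models_variety E : is_variety (models E).
Proof.
split.
- move=> M N f fM f_surj ME p q Epq g.
  have [h hE] := choice (fun i => f_surj (g i)).
  have -> : g = f \o h by apply: funext => i /=; rewrite hE.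
  by rewrite -!eval_morph // (ME _ _ Epq).
- move=> M S N ME p q Epq g; apply: val_inj.
  have valM : monoid_morphism (val : N -> M).
    by split; [exact: gmulf1 | exact: gmulfM].
  by rewrite !(eval_morph _ _ valM) (ME _ _ Epq).
- move=> I M ME p q Epq f; apply: functional_extensionality_dep => i.
  by rewrite !eval_prod (ME i _ _ Epq).
Qed.

(* The submonoid generated by the generators in a product of members of [V],
   one per identity failing in [V], is relatively free. *)
Theorem Birkhoff (V : monoidClass) (N : monoidType) :
  is_variety V -> models (theory V) N -> V N.
Proof.
move=> varV NV.
have failure (pq : seq N * seq N) : exists Bg : {B : monoidType & N -> B},
    V (projT1 Bg) /\ (eval (projT2 Bg) pq.1 = eval (projT2 Bg) pq.2 ->
                      forall M, V M -> satisfies M pq.1 pq.2).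
  have [all|/existsNP[M /not_implyP[VM /existsNP[g gpq]]]] :=
      pselect (forall M, V M -> satisfies M pq.1 pq.2).
    (* An identity valid throughout [V] needs no counterexample; the empty product, a trivial monoid
       in [V], fills its coordinate. *)
    pose B := prodMonoid (fun v : void => of_void monoidType v).
    exists (existT _ (B : monoidType) (fun=> 1)); split=> //=.
    by apply: (variety_prod varV) => -[].
  by exists (existT _ M g).
have {failure}[Bg BgP] := choice failure.
pose P : monoidType := prodMonoid (fun pq => projT1 (Bg pq)).
pose gen (x : N) : P := fun pq => projT2 (Bg pq) x.
have VP : V P by apply: (variety_prod varV) => pq; case: (BgP pq).
(* Equality at the coordinate [(p, q)] rules out a failure there, so the identity lies in the theory
   of [V], which [N] models. *)
have gen_satisfies p q : eval gen p = eval gen q -> satisfies N p q.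
  move=> /(congr1 (fun u => u (p, q))); rewrite !eval_prod => pq.
  have [p' [q' [to_nat of_nat]]] := satisfies_nat p q.
  apply/of_nat/NV => M VM; apply: to_nat.
  by case: (BgP (p, q)) => _; apply.
pose F : monoidType := imageMonoid gen.
have word (u : F) : exists w, eval gen w = val u by exact/asboolP/(valP u).
have [rep repP] := choice word.
pose f (u : F) : N := eval id (rep u).
have fE u w : eval gen w = val u -> f u = eval id w.
  by rewrite -repP => /esym/gen_satisfies; apply.
apply: (@variety_image V varV F N f).
- split; first by rewrite (fE 1 [::]).
  move=> u v; rewrite (fE _ (rep u ++ rep v)) ?eval_cat //.
  by rewrite !repP.
- move=> y; have y_im : in_image gen (eval gen [:: y]).
    by apply/asboolP; exists [:: y].
  by exists (Sub (eval gen [:: y]) y_im); rewrite (fE _ [:: y]) //= mulg1.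
- exact: imageMonoid_variety.
Qed.
(* A set of identities is a subset of a countable set, hence a binary sequence. *)
Lemma continuum_many_subvarieties (V0 : monoidClass)
    (G : (nat -> bool) -> monoidClass) :
  injective G -> (forall S, is_subvariety (G S) V0) ->
  has_continuum_many (fun V => is_subvariety V V0).
Proof.
move=> G_inj G_sub.
(* Numbers encoding no pair of words get the constant value [True], so the sequence depends on the
   theory alone. *)
pose code (V : monoidClass) : nat -> bool := fun c =>
  `[< if unpickle c is Some pq then theory V pq.1 pq.2 else True >].
pose decode (s : nat -> bool) := models (fun p q => s (pickle (p, q))).
have codeK V : is_variety V -> decode (code V) = V.
  move=> varV; apply: funext => M; apply: propext; split=> [MV|VM p q].
    apply: Birkhoff => // p q pq; apply: MV.
    by rewrite /code pickleK; apply/asboolP.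
  by rewrite /code pickleK => /asboolP; apply.
pose A : set (nat -> bool) :=
  [set s | exists2 V, is_subvariety V V0 & code V = s]%classic.
have /card_set_bijP[f [fA f_inj f_surj]] :
    ([set: nat -> bool]%classic #= A)%card.
  apply: Cantor_Bernstein; last exact/subset_card_le/subsetT.
  apply/pcard_leP/injfunPex; exists (code \o G).
    by move=> S _; exists (G S).
  move=> S S' _ _ /(congr1 decode) /=.
  by rewrite !codeK; [exact: G_inj | case: (G_sub S') | case: (G_sub S)].
exists (decode \o f); split=> [s t /= st | V].
  have [[V [varV _] codeV] [W [varW _] codeW]] := (fA s I, fA t I).
  apply: f_inj; rewrite ?in_setT //; move: st.
  by rewrite -codeV -codeW !codeK // => ->.
split=> [subV | [s <-]].
  have [s _ fs] := f_surj (code V) (ex_intro2 _ _ V subV erefl).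
  by exists s; rewrite /= fs codeK //; case: subV.
by rewrite /=; have [W subW <-] := fA s I; rewrite codeK //; case: subW.
Qed.

(** * Syntactic monoids *)

Section SyntacticMonoid.
Variables (X : choiceType) (L : seq X -> Prop).

(** The syntactic congruence of the language [L]. *)
Definition syntactic_equiv : rel (seq X) := fun p q =>
  `[< forall a b, L (a ++ p ++ b) <-> L (a ++ q ++ b) >].

Let syntactic_refl : reflexive syntactic_equiv.
Proof. by move=> p; apply/asboolP. Qed.
Let syntactic_sym : symmetric syntactic_equiv.
Proof.
by move=> p q; apply/asboolP/asboolP => pq a b; split=> /pq.
Qed.
Let syntactic_trans : transitive syntactic_equiv.
Proof.
move=> q p r /asboolP pq /asboolP qr; apply/asboolP => a b.
exact: iff_trans (pq a b) (qr a b).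
Qed.

Canonical syntactic_equiv_rel :=
  EquivRel syntactic_equiv syntactic_refl syntactic_sym syntactic_trans.

Definition syntacticMonoid : Type := {eq_quot syntactic_equiv_rel}%qT.

HB.instance Definition _ := Choice.on syntacticMonoid.
HB.instance Definition _ := EqQuotient.on syntacticMonoid.

Definition syntactic_class (w : seq X) : syntacticMonoid :=
  (\pi_syntacticMonoid w)%qT.

Lemma syntactic_classP p q :
  syntactic_class p = syntactic_class q <->
  forall a b, L (a ++ p ++ b) <-> L (a ++ q ++ b).
Proof.
split; first by move/(@eqquotP _ syntactic_equiv_rel syntacticMonoid)/asboolP.
by move=> pq; apply/(@eqquotP _ syntactic_equiv_rel syntacticMonoid)/asboolP.
Qed.

Let repr_classK : cancel repr syntactic_class.
Proof. exact: reprK. Qed.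

Let smul (u v : syntacticMonoid) : syntacticMonoid :=
  syntactic_class (repr u ++ repr v).

Let syntactic_class_cat p q :
  syntactic_class (p ++ q) = smul (syntactic_class p) (syntactic_class q).
Proof.
apply/syntactic_classP => a b.
have /syntactic_classP pP := esym (repr_classK (syntactic_class p)).
have /syntactic_classP qP := esym (repr_classK (syntactic_class q)).
by rewrite -!catA pP [a ++ _]catA qP -catA.
Qed.

Let smulA : associative smul.
Proof.
move=> u v w; rewrite -[u]repr_classK -[v]repr_classK -[w]repr_classK.
by rewrite -!syntactic_class_cat catA.
Qed.
Let smul1w : left_id (syntactic_class [::]) smul.
Proof. by move=> u; rewrite -[u]repr_classK -syntactic_class_cat. Qed.
Let smulw1 : right_id (syntactic_class [::]) smul.
Proof. by move=> u; rewrite -[u]repr_classK -syntactic_class_cat cats0. Qed.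

HB.instance Definition _ := isMonoid.Build syntacticMonoid smulA smul1w smulw1.

Lemma eval_syntactic_class (Y : Type) (phi : Y -> seq X) (w : seq Y) :
  eval (syntactic_class \o phi) w = syntactic_class (flatten (map phi w)).
Proof. by elim: w => //= y w ->; rewrite syntactic_class_cat. Qed.

(** Every valuation lifts to a substitution by words, through representatives of the classes. *)
Lemma syntacticMonoid_satisfies (Y : Type) (p q : seq Y) :
  satisfies syntacticMonoid p q <->
  forall (phi : Y -> seq X) a b,
    L (a ++ flatten (map phi p) ++ b) <-> L (a ++ flatten (map phi q) ++ b).
Proof.
split=> [pq phi | pq f].
  by apply/syntactic_classP; rewrite -!eval_syntactic_class.
have -> : f = syntactic_class \o (repr \o f).
  by apply: funext => y /=; rewrite repr_classK.
by rewrite !eval_syntactic_class; apply/syntactic_classP.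
Qed.
End SyntacticMonoid.

Local Open Scope nat_scope.

(** * Subwords *)

Lemma count_pred2 (X : eqType) (i j : X) (w : seq X) : i != j ->
  count (pred2 i j) w = count_mem i w + count_mem j w.
Proof.
move=> ij; elim: w => //= x w ->; case: (x =P i) => [-> | _] /=.
  by rewrite (negPf ij) addnA.
by rewrite addnCA.
Qed.

Lemma subseq_catl_notin (X : eqType) (c : X) (s a r : seq X) :
  c \notin a -> subseq (c :: s) (a ++ r) = subseq (c :: s) r.
Proof.
elim: a => //= x a IHa; rewrite inE => /norP[/negPf-> /IHa]; exact.
Qed.

Lemma subseq_catr_notin (X : eqType) (c : X) (s r b : seq X) :
  c \notin b -> subseq (rcons s c) (r ++ b) = subseq (rcons s c) r.
Proof.
move=> cb; rewrite -[LHS]subseq_rev -[RHS]subseq_rev rev_rcons rev_cat.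
by rewrite subseq_catl_notin ?mem_rev.
Qed.

Lemma subseq_flatten_map (X Y : eqType) (phi : X -> seq Y) (s t : seq X) :
  subseq s t -> subseq (flatten (map phi s)) (flatten (map phi t)).
Proof.
elim: t s => [|y t IHt] [|x s] //= xs; first exact: sub0seq.
case: eqP xs => [<- | _] /IHt ? ; first exact: cat_subseq.
exact: subseq_trans (suffix_subseq _ _).
Qed.

Lemma subseq_pair (X : eqType) (i j : X) (s : seq X) :
  i \in s -> j \in s -> i != j -> subseq [:: i; j] s \/ subseq [:: j; i] s.
Proof.
elim: s => //= x s IHs; rewrite !inE.
case/orP=> [/eqP-> | si]; case/orP=> [/eqP-> | sj].
- by rewrite eqxx.
- by rewrite eqxx sub1seq; left.
- by rewrite eqxx sub1seq; right.
- move=> ij; case: (IHs si sj ij) => h; [left|right];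
    exact: subseq_trans h (subseq_cons _ _).
Qed.

Lemma subseq_catP (X : eqType) (s a b : seq X) : subseq s (a ++ b) ->
  exists s1 s2, [/\ s = s1 ++ s2, subseq s1 a & subseq s2 b].
Proof.
case/subseqP=> m; rewrite size_cat => sz ->.
exists (mask (take (size a) m) a), (mask (drop (size a) m) b).
rewrite !mask_subseq -mask_cat ?cat_take_drop // size_takel //.
by rewrite sz leq_addr.
Qed.

(** Consecutive letters of [s] belong to different blocks, so each block contributes at most one
    letter, which can be contracted to the name of the block. *)
Lemma subseq_map_flatten (X Y : eqType) (phi : X -> seq Y) (h : Y -> X)
    (s : seq Y) (t : seq X) :
  (forall c x, c \in s -> x \in t -> c \in phi x -> h c = x) ->
  sorted (fun c d => h c != h d) s ->
  subseq s (flatten (map phi t)) -> subseq (map h s) t.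
Proof.
elim: t s => [|x t IHt] s hP s_sorted /=; first by case: s hP s_sorted.
have IH r : subseq r s -> subseq r (flatten (map phi t)) ->
    sorted (fun c d => h c != h d) r -> subseq (map h r) t.
  move=> rs rt r_sorted; apply: IHt => // c y cr yt.
  by apply: hP; rewrite ?(mem_subseq rs) // inE yt orbT.
case/subseq_catP=> -[|c [|d s1]] [s2 [sE]] s1x s2t.
- subst s.
  exact: subseq_trans (IH _ (subseq_refl _) s2t s_sorted) (subseq_cons _ _).
- have hc : h c = x by apply: hP; rewrite ?sE ?mem_head // -sub1seq.
  rewrite sE /= hc eqxx; apply: IH => //; first by rewrite sE subseq_cons.
  by move: s_sorted; rewrite sE => /path_sorted.
- have hc : h c = x.
    by apply: hP; rewrite ?sE ?mem_head ?(mem_subseq s1x) ?mem_head.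
  have hd : h d = x.
    by apply: hP; rewrite ?sE ?mem_head ?(mem_subseq s1x) // !inE eqxx ?orbT.
  by move: s_sorted; rewrite sE /= hc hd eqxx.
Qed.

(** * The cycle words *)

(** The general formula alone gives [1 0 2 1 3 2 ... n+1 n], whose crossings form a path; turning
    the letter [n+1], at position [2n], into [0] closes the cycle. *)
Definition cycle_letter (n p : nat) : nat :=
  if (p == 1) || (p == n.*2) then 0 else p./2 + ~~ odd p.

(* [1 0 (2 1) (3 2) ... (n n-1) 0 n]: the letter [i > 0] occupies the positions
   [2i-2] and [2i+1], the letter [0] the positions [1] and [2n]. *)
Definition cycle_word (n : nat) : seq nat := mkseq (cycle_letter n) (n.+1).*2.

Definition square_word (n : nat) : seq nat := iota 0 n.+1 ++ iota 0 n.+1.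

(** The orientation is not cyclic: two directed paths lead from [1] to [n], one through
    [2, ..., n-1] and the other through [0]. *)
Definition cycle_edge (n i j : nat) : bool :=
  [|| (0 < i < n) && (j == i.+1), (i == 1) && (j == 0) | (i == 0) && (j == n)].

Definition fst_pos (c : nat) := if c == 0 then 1 else (c.-1).*2.
Definition snd_pos (n c : nat) := if c == 0 then n.*2 else c.*2.+1.

Lemma cycle_letterE n p c : 1 < n -> p < (n.+1).*2 ->
  (cycle_letter n p == c) =
  (c <= n) && ((p == fst_pos c) || (p == snd_pos n c)).
Proof.
rewrite /cycle_letter /fst_pos /snd_pos; case: ifP; case: ifP; lia.
Qed.

Lemma count_cycle_word n c : 1 < n ->
  count_mem c (cycle_word n) = if c <= n then 2 else 0.
Proof.
move=> n1; rewrite count_map.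
have -> : count (preim (cycle_letter n) (pred1 c)) (iota 0 (n.+1).*2) =
    count (fun p => (c <= n) && ((p == fst_pos c) || (p == snd_pos n c)))
      (iota 0 (n.+1).*2).
  by apply: eq_in_count => p; rewrite mem_iota /= => pn; rewrite cycle_letterE.
case: ifP => cn /=; last exact: count_pred0.
have pos_neq : fst_pos c != snd_pos n c.
  by rewrite /fst_pos /snd_pos; case: ifP; lia.
rewrite (count_pred2 _ pos_neq) !count_uniq_mem ?iota_uniq // !mem_iota.
by rewrite /fst_pos /snd_pos; case: ifP; lia.
Qed.

Lemma count_square_word n c :
  count_mem c (square_word n) = if c <= n then 2 else 0.
Proof.
rewrite count_cat !count_uniq_mem ?iota_uniq // mem_iota add0n ltnS.
by case: ifP.
Qed.

Lemma subseq_mkseqP (X : eqType) (g : nat -> X) (N : nat) (s : seq X) :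
  reflect (exists2 r, sorted ltn r /\ all (gtn N) r & s = map g r)
    (subseq s (mkseq g N)).
Proof.
apply: (iffP idP) => [/subseqP[m sz ->]|[r [r_sorted rN] ->]].
  exists (mask m (iota 0 N)); last by rewrite map_mask.
  have sub := mask_subseq m (iota 0 N).
  split; first exact: (subseq_sorted ltn_trans sub (iota_ltn_sorted 0 N)).
  by apply/allP => x /(mem_subseq sub); rewrite mem_iota.
apply: map_subseq.
suff -> : r = filter (mem r) (iota 0 N) by exact: filter_subseq.
apply: (irr_sorted_eq ltn_trans ltnn) => //.
  exact: (sorted_filter ltn_trans _ (iota_ltn_sorted 0 N)).
move=> x; rewrite mem_filter mem_iota /= add0n.
by case: (boolP (x \in r)) => //= /(allP rN).
Qed.

(** Each letter has only two positions, so a crossing amounts to the inequalities [fst_pos i <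
    fst_pos j < snd_pos n i < snd_pos n j]. *)
Lemma cycle_word_cross n i j : 3 < n -> i != j ->
  subseq [:: i; j; i; j] (cycle_word n) = cycle_edge n i j.
Proof.
move=> n3 ij; have n1 : 1 < n by lia.
apply/subseq_mkseqP/idP => [[r [r_sorted rN]] | e].
  case: r r_sorted rN => [|p1 [|p2 [|p3 [|p4 []]]]] // r_sorted rN.
  move: r_sorted rN => /= /and4P[s1 s2 s3 _] /and5P[b1 b2 b3 b4 _].
  case=> /esym/eqP + /esym/eqP + /esym/eqP + /esym/eqP.
  rewrite !cycle_letterE //; move: s1 s2 s3.
  rewrite /fst_pos /snd_pos /cycle_edge.
  case: ifP; case: ifP; lia.
exists [:: fst_pos i; fst_pos j; snd_pos n i; snd_pos n j].
  split=> /=; move: e; rewrite /fst_pos /snd_pos /cycle_edge;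
    case: ifP; case: ifP; lia.
have E c p : p < (n.+1).*2 -> c <= n ->
    (p == fst_pos c) || (p == snd_pos n c) -> cycle_letter n p = c.
  by move=> pn cn pc; apply/eqP; rewrite cycle_letterE // cn.
congr [:: _; _; _; _]; apply/esym/E; move: e;
  rewrite /fst_pos /snd_pos /cycle_edge; do ?case: ifP; lia.
Qed.

(** * Identities of M{xyxy} *)

Lemma eval_factorMonoid (X : Type) (A : choiceType) (w : seq A)
    (s : X -> {u : seq A | infix u w}) (p : seq X) :
  eval (fun x => Some (s x) : factorMonoid w) p =
  insub (flatten [seq val (s x) | x <- p]).
Proof.
elim: p => /= [|x p ->].
  by rewrite (insubT (fun u => infix u w) (infix0s _)).
case: (insubP _ (flatten _)) => [r _ <- //|np].
rewrite [RHS]insubN //; apply: contra np; exact: catl_infix.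
Qed.

(** The substitution gives [p] the nonzero value [w]; [q] has the same value, and nonzero values are
    genuine words. *)
Lemma factorMonoid_satisfies (X : Type) (A : choiceType) (w : seq A)
    (s : X -> seq A) (p q : seq X) :
  (forall x, infix (s x) w) -> satisfies (factorMonoid w) p q ->
  flatten (map s p) = w -> flatten (map s q) = w.
Proof.
move=> sw pq pw; have := pq (fun x => Some (exist _ (s x) (sw x))).
rewrite !eval_factorMonoid /= pw (insubT (fun u => infix u w) (infix_refl _)).
by case: insubP => //= u _ <- [<-].
Qed.

Section Identities.
Variables (X : eqType) (p q : seq X).
Hypothesis pq : satisfies (factorMonoid xyxy) p q.

Lemma satisfies_count2 (c : X) : count_mem c p = 2 -> count_mem c q = 2.
Proof.
(* Sending [c] to [xy] and erasing the rest yields [xyxy] exactly for two occurrences of [c]. *)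
pose s x := if x == c then [:: false; true] else [::].
have sE r : flatten (map s r) = flatten (nseq (count_mem c r) [:: false; true]).
  by elim: r => //= x r ->; rewrite /s; case: eqP.
have sw x : infix (s x) xyxy by rewrite /s; case: eqP.
move=> cp; have pE : flatten (map s p) = xyxy by rewrite sE cp.
have := congr1 size (factorMonoid_satisfies sw pq pE).
by rewrite sE size_flatten /shape map_nseq sumn_nseq /=; lia.
Qed.

Lemma satisfies_count0 (c : X) : count_mem c p = 0 -> count_mem c q = 0.
Proof.
pose zero : factorMonoid xyxy := None.
pose f x : factorMonoid xyxy := if x == c then zero else 1%g.
have fE r : eval f r = if c \in r then zero else 1%g.
  elim: r => //= x r ->; rewrite inE /f eq_sym.
  by case: eqP => //= _; rewrite mul1g.
move/count_memPn => cp; apply/count_memPn.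
by have := pq f; rewrite !fE (negPf cp); case: ifP.
Qed.

Lemma satisfies_filter2 (i j : X) : i != j ->
  filter (pred2 i j) p = [:: i; j; i; j] ->
  filter (pred2 i j) q = [:: i; j; i; j].
Proof.
move=> ij pij.
(* [i] becomes [x], [j] becomes [y], and all other letters are erased. *)
pose s x := if pred2 i j x then [:: x == j] else [::].
have sE r : flatten (map s r) = map (eq_op^~ j) (filter (pred2 i j) r).
  by elim: r => //= x r ->; rewrite /s /=; case: ifP.
have sw x : infix (s x) xyxy by rewrite /s; case: ifP => // _; case: eqP.
have := factorMonoid_satisfies sw pq; rewrite !sE pij /=.
rewrite eqxx (negPf ij) => /(_ erefl).
move/(congr1 (map (fun b => if b then j else i))).
rewrite -map_comp map_id_in //= => x.
rewrite mem_filter => /andP[/orP[]/eqP-> _] /=.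
  by rewrite (negPf ij).
by rewrite eqxx.
Qed.
End Identities.

Lemma subseq_filter2P (X : eqType) (i j : X) (w : seq X) : i != j ->
  count_mem i w = 2 -> count_mem j w = 2 ->
  reflect (filter (pred2 i j) w = [:: i; j; i; j]) (subseq [:: i; j; i; j] w).
Proof.
move=> ij iw jw; apply: (iffP idP) => [sub|<-]; last exact: filter_subseq.
have sz : size (filter (pred2 i j) w) = 4.
  by rewrite size_filter count_pred2 // iw jw.
apply/esym/eqP; rewrite -(size_subseq_leqif _).2 ?sz //.
by rewrite subseq_filter sub /= !eqxx !orbT.
Qed.

(** * Words that M{xyxy} does not separate from a cycle word *)

Section CycleClass.
Variable n : nat.
Hypothesis n_gt3 : 3 < n.
Variable w : seq nat.
Hypothesis w_cycle : satisfies (factorMonoid xyxy) (cycle_word n) w.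

Lemma count_cycle_class c : count_mem c w = if c <= n then 2 else 0.
Proof.
have n_gt1 : 1 < n by lia.
case: ifP => cn;
  [apply: (satisfies_count2 w_cycle) | apply: (satisfies_count0 w_cycle)];
  by rewrite count_cycle_word // cn.
Qed.

Lemma cross_cycle_class i j : i != j -> i <= n -> j <= n ->
  subseq [:: i; j; i; j] w = cycle_edge n i j.
Proof.
move=> ij i_n j_n; have n_gt1 : 1 < n by lia.
rewrite -cycle_word_cross //.
have cE c : c <= n -> count_mem c w = 2 by rewrite count_cycle_class => ->.
have uE c : c <= n -> count_mem c (cycle_word n) = 2.
  by rewrite count_cycle_word // => ->.
have w_cycle' : satisfies (factorMonoid xyxy) w (cycle_word n).
  by move=> f; rewrite w_cycle.
have wP := subseq_filter2P ij (cE i i_n) (cE j j_n).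
have uP := subseq_filter2P ij (uE i i_n) (uE j j_n).
by apply/wP/uP; apply: satisfies_filter2.
Qed.
End CycleClass.

(* The crossing graph of [w] is connected, so a factor of [w] containing both
   occurrences of each of its letters contains every letter. *)
Lemma cycle_class_factor n (a p b : seq nat) : 3 < n ->
  satisfies (factorMonoid xyxy) (cycle_word n) (a ++ p ++ b) ->
  p <> [::] -> (forall c, c \in p -> 1 < count_mem c p) ->
  forall i, i <= n -> i \in p.
Proof.
move=> n_gt3 w_cycle p_neq0 p_closed.
have p_le c : c \in p -> c <= n.
  move/p_closed; have := count_cycle_class n_gt3 w_cycle c.
  by rewrite !count_cat; case: ifP => //; lia.
have out c : c \in p -> (c \notin a) && (c \notin b).
  move/p_closed => c2; have := count_cycle_class n_gt3 w_cycle c.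
  rewrite !count_cat => cw; apply/andP; split; apply/count_memPn;
  by move: cw; case: ifP; lia.
(* Both occurrences of [c] lie in [p], hence so does everything between them; a crossing puts a
   neighbour there. *)
have between c d : c \in p -> subseq [:: c; d; c] (a ++ p ++ b) -> d \in p.
  move=> /out /andP[ca cb]; rewrite subseq_catl_notin //.
  rewrite -[[:: c; d; c]]/(rcons [:: c; d] c) subseq_catr_notin //.
  move/mem_subseq.
  by apply; rewrite !inE eqxx orbT.
have nbr c d : c != d -> d <= n -> cycle_edge n c d || cycle_edge n d c ->
    c \in p -> d \in p.
  move=> cd dn e cp; apply: (between c) => //; have cn := p_le c cp.
  case/orP: e; rewrite -(cross_cycle_class n_gt3 w_cycle) // 1?eq_sym //.
    exact/subseq_trans/(prefix_subseq [:: c; d; c] [:: d]).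
  exact/subseq_trans/(suffix_subseq [:: d] [:: c; d; c]).
(* From any letter of [p], adjacency leads to [1], and from [1] to all the others. *)
have down c : c.+1 \in p -> 1 \in p.
  elim: c => // c IHc cp; apply/IHc/nbr/cp; have := p_le _ cp;
    rewrite /cycle_edge; lia.
have one : 1 \in p.
  case: p p_neq0 down nbr {p_le out between p_closed w_cycle} => //.
  move=> c q _ down nbr.
  have := mem_head c q; case: c down nbr => [|c] down nbr; last exact: down.
  by apply: nbr; rewrite /cycle_edge; lia.
have up i : i < n -> i.+1 \in p.
  elim: i => // i IHi i_n; apply: (nbr i.+1); rewrite /cycle_edge; try lia.
  by apply: IHi; lia.
case=> [_|i]; last exact: up.
by apply: (nbr 1) => //; rewrite /cycle_edge; lia.
Qed.

(** Any two letters of a square cross in one of the two orders, whereas [1] and [3] are not adjacent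
    in the cycle. *)
Lemma cycle_class_square n (a p b : seq nat) : 3 < n -> p <> [::] ->
  ~ satisfies (factorMonoid xyxy) (cycle_word n) (a ++ (p ++ p) ++ b).
Proof.
move=> n_gt3 p_neq0 w_cycle.
have all_in i : i <= n -> i \in p.
  move=> i_n; have : i \in p ++ p.
    apply: (cycle_class_factor n_gt3 w_cycle) i_n.
      by case: p p_neq0 {w_cycle}.
    by move=> c; rewrite mem_cat orbb count_cat -has_pred1 has_count; lia.
  by rewrite mem_cat orbb.
have cross i j :
    subseq [:: i; j] p -> subseq [:: i; j; i; j] (a ++ (p ++ p) ++ b).
  move=> ijp; apply: subseq_trans (suffix_subseq a _).
  exact: subseq_trans (cat_subseq ijp ijp) (prefix_subseq _ b).
have [] : subseq [:: 1; 3] p \/ subseq [:: 3; 1] p.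
  by apply: subseq_pair => //; apply: all_in; lia.
all: move/cross; rewrite (cross_cycle_class n_gt3 w_cycle) // /cycle_edge; lia.
Qed.

Lemma flatten_square_word m (phi : nat -> seq nat) :
  flatten (map phi (square_word m)) =
  flatten (map phi (iota 0 m.+1)) ++ flatten (map phi (iota 0 m.+1)).
Proof. by rewrite /square_word map_cat flatten_cat. Qed.

Lemma perm_cycle_square m : 1 < m -> perm_eq (cycle_word m) (square_word m).
Proof.
move=> m_gt1; apply/allP => c _; apply/eqP.
by rewrite count_cycle_word // count_square_word.
Qed.

(** The orientation pins [h] down. Only [1] has two outgoing edges and only [m] two incoming ones,
    so [h 1 = 1], [h n = m] and [h] maps [0], [2] onto [0], [2]. A swap would need an edge from [2]
    to [m], impossible for [m > 3]. Following the path from [2] then gives [h n = n]. *)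
Lemma edge_preserving_eq n m (h : nat -> nat) : 3 < n -> 3 < m ->
  (forall i, i <= n -> h i <= m) ->
  (forall i j, i <= n -> j <= n -> i != j -> h i != h j) ->
  (forall i j, i <= n -> j <= n -> i != j ->
     cycle_edge n i j = cycle_edge m (h i) (h j)) ->
  n = m.
Proof.
move=> n_gt3 m_gt3 h_le h_inj h_edge.
have h_edge_succ i : 0 < i < n -> cycle_edge m (h i) (h i.+1).
  by move=> i_n; rewrite -h_edge /cycle_edge; lia.
have e12 := h_edge_succ 1 ltac:(lia).
have e_last := h_edge_succ n.-1 ltac:(lia).
have e10 : cycle_edge m (h 1) (h 0) by rewrite -h_edge /cycle_edge; lia.
have e0n : cycle_edge m (h 0) (h n) by rewrite -h_edge /cycle_edge; lia.
have h02 := h_inj 0 2 isT ltac:(lia) isT.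
have h0p := h_inj 0 n.-1 isT ltac:(lia) ltac:(lia).
rewrite prednK in e_last; last lia.
have [h0 h2] : h 0 = 0 /\ h 2 = 2.
  by move: e12 e10 e0n e_last h02 h0p; rewrite /cycle_edge; lia.
have h_id i : 1 < i <= n -> h i = i.
  elim: i => // -[|[|i]] IHi i_n; [by [] | exact: h2 |].
  have := h_edge_succ i.+2 ltac:(lia).
  have := h_inj 0 i.+3 isT ltac:(lia) isT.
  by rewrite IHi ?h0 /cycle_edge; lia.
have := e0n; rewrite h0 h_id /cycle_edge; lia.
Qed.

(** Two distinct blocks containing [c] would already provide two occurrences. *)
Lemma flatten_block_inj (X Y : eqType) (phi : X -> seq Y) (s : seq X) (c : Y)
    (x y : X) :
  count_mem c (flatten (map phi s)) <= 1 ->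
  x \in s -> y \in s -> c \in phi x -> c \in phi y -> x = y.
Proof.
move=> c1 xs ys cx cy; apply/eqP; apply: contraLR c1 => xy; rewrite -ltnNge.
have le2 z : c \in phi z -> 0 < count_mem c (phi z).
  by rewrite -has_count has_pred1.
have [] := subseq_pair xs ys xy;
  move/(subseq_flatten_map phi)/(leq_count_subseq (pred1 c));
  by rewrite /= !cats0 count_cat; have := le2 _ cx; have := le2 _ cy; lia.
Qed.

(** [k] is the other neighbour of [i] on the cycle; a cycle without triangles keeps it away from
    [j]. *)
Lemma cycle_edge_third n i j : 3 < n -> cycle_edge n i j ->
  exists k, [/\ [/\ k <= n, k != i & k != j],
    cycle_edge n k i || cycle_edge n i k &
    ~~ (cycle_edge n k j || cycle_edge n j k)].
Proof.
move=> n_gt3 e.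
exists (if i == 0 then 1 else
        if i == 1 then (if j == 0 then 2 else 0) else i.-1).
split; first split; move: e; rewrite /cycle_edge;
  do ?case: ifP; lia.
Qed.

(* Each letter [i <= n] comes from exactly one letter [h i] of [cycle_word m];
   letters in a common block cross each other and have the same neighbours, so
   [h] is injective as the cycle has no triangle. *)
Lemma cycle_class_cycle n m (a b : seq nat) (phi : nat -> seq nat) :
  3 < n -> 3 < m -> flatten (map phi (cycle_word m)) <> [::] ->
  satisfies (factorMonoid xyxy) (cycle_word n)
    (a ++ flatten (map phi (cycle_word m)) ++ b) ->
  n = m.
Proof.
move=> n_gt3 m_gt3; set p := flatten _ => p_neq0 w_cycle.
pose s := flatten (map phi (iota 0 m.+1)).
have perm_m : perm_eq (cycle_word m) (square_word m).
  by apply: perm_cycle_square; lia.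
(* Multiplicities ignore order, so [p] may be replaced by the square of [s]. *)
have count_p c : count_mem c p = (count_mem c s).*2.
  have /permP -> : perm_eq p (flatten (map phi (square_word m))).
    exact/perm_flatten/perm_map.
  by rewrite flatten_square_word count_cat addnn.
have p_closed c : c \in p -> 1 < count_mem c p.
  by rewrite -has_pred1 has_count; have := count_p c; lia.
have in_p := cycle_class_factor n_gt3 w_cycle p_neq0 p_closed.
have count_w c : c <= n -> count_mem c a + (count_mem c p + count_mem c b) = 2.
  move=> cn; have := count_cycle_class n_gt3 w_cycle c.
  by rewrite (count_cat _ a) (count_cat _ p) cn.
have count_s c : c <= n -> count_mem c s <= 1.
  by move=> /count_w; have := count_p c; lia.
have out c : c <= n -> c \notin a /\ c \notin b.
  move=> cn; have := p_closed c (in_p c cn).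
  have cw := count_w c cn => c2.
  by split; apply/count_memPn; lia.
have mem_m x : (x \in cycle_word m) = (x <= m).
  by rewrite (perm_mem perm_m) mem_cat orbb mem_iota.
have block i : exists x, i <= n -> x <= m /\ i \in phi x.
  have [/in_p/flatten_mapP[x]|_] := boolP (i <= n); last by exists 0.
  by rewrite mem_m => xm ix; exists x.
have [h hP] := choice block.
have block_uniq i x : i <= n -> x <= m -> i \in phi x -> h i = x.
  move=> i_n x_m ix; have [hm ih] := hP i i_n.
  by apply: (flatten_block_inj (count_s i i_n)) => //; rewrite mem_iota; lia.
pose w := a ++ p ++ b.
have w_cross i j : i <= n -> j <= n -> i != j ->
    subseq [:: i; j; i; j] w = cycle_edge n i j.
  by move=> i_n j_n ij; apply: cross_cycle_class.
have sub_w r : subseq r p -> subseq r w.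
  move=> rp; apply: subseq_trans (suffix_subseq a _).
  exact: subseq_trans rp (prefix_subseq _ b).
have cross_block i j x : x <= m -> i <= n -> j <= n -> i != j ->
    subseq [:: i; j] (phi x) -> cycle_edge n i j.
  move=> xm i_n j_n ij ijx; rewrite -w_cross //; apply: sub_w.
  (* The block of [x] occurs twice, so [i j] inside it yields [i j i j]. *)
  have xx : subseq [:: x; x] (cycle_word m).
    have /all_pred1P := filter_all (pred1 x) (cycle_word m).
    rewrite size_filter count_cycle_word ?xm; last by lia.
    by rewrite -[[:: x; x]]/(nseq 2 x) => <-; exact: filter_subseq.
  have := subseq_flatten_map phi xx; rewrite /= cats0.
  exact/subseq_trans/(cat_subseq ijx ijx).
have same_block i j : i <= n -> j <= n -> i != j -> h i = h j ->
    cycle_edge n i j || cycle_edge n j i.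
  move=> i_n j_n ij hij; have [xm ix] := hP i i_n; have [_ jx] := hP j j_n.
  rewrite -hij in jx; case: (subseq_pair ix jx ij) => /cross_block -> //.
    by rewrite orbT.
  by rewrite eq_sym.
have edgeE i j : i <= n -> j <= n -> i != j -> h i != h j ->
    cycle_edge n i j = cycle_edge m (h i) (h j).
  move=> i_n j_n ij hij; have [im ih] := hP i i_n; have [jm jh] := hP j j_n.
  rewrite -(cycle_word_cross m_gt3 hij) -w_cross //; apply/idP/idP => sub.
    apply: (@subseq_map_flatten _ _ phi h [:: i; j; i; j]) => /=.
    - move=> c x c_ij; rewrite mem_m => xm; apply: block_uniq => //.
      by move: c_ij; rewrite !inE => /or4P[] /eqP->.
    - by rewrite hij eq_sym hij.
    - have := sub; rewrite subseq_catl_notin ?(proj1 (out i i_n)) //.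
      rewrite -[[:: i; j; i; j]]/(rcons [:: i; j; i] j).
      by rewrite subseq_catr_notin ?(proj2 (out j j_n)).
  apply: sub_w; apply: subseq_trans (subseq_flatten_map phi sub).
  rewrite /= cats0 -[[:: i; j; i; j]]/([:: i] ++ [:: j] ++ [:: i] ++ [:: j]).
  by do ![apply: cat_subseq | rewrite sub1seq].
have h_inj i j : i <= n -> j <= n -> i != j -> h i != h j.
  move=> i_n j_n ij; apply/negP => /eqP hij.
  wlog e : i j i_n j_n ij hij / cycle_edge n i j.
    move=> no_edge; case/orP: (same_block i j i_n j_n ij hij) => e.
      exact: no_edge e.
    by apply: no_edge e; rewrite // eq_sym.
  have [k [[k_n ki kj] ik jk]] := cycle_edge_third n_gt3 e.
  (* If [k] shares the block of [j], they cross. Otherwise adjacency to [k] depends only on the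
     block, so [j] inherits it from [i]. *)
  case/negP: jk.
  have [hkj|hkj] := eqVneq (h k) (h j); first exact: same_block.
  have [ik' jk'] : i != k /\ j != k by rewrite ![_ == k]eq_sym.
  have hjk : h j != h k by rewrite eq_sym.
  by rewrite !edgeE // -hij -!edgeE // hij.
apply: (edge_preserving_eq n_gt3 m_gt3 (h := h)) => //.
- by move=> i /hP[].
- by move=> i j i_n j_n ij; apply/edgeE/h_inj.
Qed.

(** * Subvarieties indexed by the subsets of [nat] *)

(** Including all identities of M{xyxy} keeps the models inside the generated variety; the shift by
    4 ensures [3 < n] for the cycle words. *)
Definition cycle_identities (S : nat -> bool) (p q : seq nat) : Prop :=
  satisfies (factorMonoid xyxy) p q \/
  exists2 k, S k & p = cycle_word k.+4 /\ q = square_word k.+4.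

Definition cycle_monoid (k : nat) : monoidType :=
  syntacticMonoid (satisfies (factorMonoid xyxy) (cycle_word k.+4)).

Lemma cycle_monoid_models (S : nat -> bool) (k : nat) :
  models (cycle_identities S) (cycle_monoid k) <-> ~~ S k.
Proof.
split=> [kS | nSk p q [pq|[m Sm [-> ->]]]].
- apply/negP => Sk.
  have /syntacticMonoid_satisfies :
      satisfies (cycle_monoid k) (cycle_word k.+4) (square_word k.+4).
    by apply: kS; right; exists k.
  (* The identity substitution in the empty context would put the square itself into the class of
     the cycle word. *)
  move=> /(_ (fun x => [:: x]) [::] [::]).
  rewrite !flatten_map1 !map_id !cats0 /=.
  case=> /(_ (fun=> erefl)) k_square _.
  apply: (@cycle_class_square k.+4 [::] (iota 0 k.+4.+1) [::]) => //.
  by rewrite ?cats0.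
- apply/syntacticMonoid_satisfies => phi a b.
  have E : satisfies (factorMonoid xyxy) (a ++ flatten (map phi p) ++ b)
      (a ++ flatten (map phi q) ++ b).
    by move=> f; rewrite !eval_cat !eval_flatten pq.
  by split=> h f; rewrite h E.
- apply/syntacticMonoid_satisfies => phi a b.
  have /perm_flatten perm_phi :=
    perm_map phi (@perm_cycle_square m.+4 isT).
  (* Both instances are permutations of each other, so they are empty together; if nonempty, neither
     can be a factor of a word in the class. *)
  have [phi0|phi_neq0] := eqVneq (flatten (map phi (cycle_word m.+4))) [::].
    rewrite phi0; rewrite phi0 in perm_phi.
    by move: perm_phi; rewrite perm_sym => /perm_nilP ->.
  split=> h.
    have [km] : k.+4 = m.+4 by apply: cycle_class_cycle h => //; exact/eqP.
    by rewrite km Sm in nSk.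
  rewrite flatten_square_word in h perm_phi.
  case: (cycle_class_square _ _ h) => // s0.
  by case/eqP: phi_neq0; apply/perm_nilP; rewrite s0 in perm_phi.
Qed.

Theorem theorem3p4 :
  has_continuum_many
    (fun V => is_subvariety V (generated_variety (factorMonoid xyxy))).
Proof.
apply: (@continuum_many_subvarieties _ (fun S => models (cycle_identities S))).
(* Membership of [cycle_monoid k] in the class recovers the value at [k]. *)
- move=> S S' SS'; apply: funext => k; apply: negb_inj.
  by apply/idP/idP; rewrite -!cycle_monoid_models SS'.
- move=> S; split; first exact: models_variety.
  (* The theory of a variety containing M{xyxy} consists of identities of M{xyxy}, all of which hold
     in [N]. *)
  move=> N NS V varV VM; apply: Birkhoff => // p q pq.
  by apply: NS; left; apply: pq.
Qed.
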